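(* Let $\mathfrak{m}$ be the least cardinal such that every infinite precompact abelian group admits an infinite quotient group of density at most $\mathfrak{m}$. Then $\ln(\mathfrak{c}^+)\le \mathfrak{m}$. In particular, if $2^{<\mathfrak{c}}=\mathfrak{c}$, then $\mathfrak{m}=\mathfrak{c}$.
   Context: All topological groups are Hausdorff. A topological group $G$ is precompact if for every neighborhood $U$ of the identity there is a finite $F\subseteq G$ with $G=FU$. A quotient group of an abelian topological group $G$ is $G/N$ with the quotient topology, where $N$ is a closed subgroup. The density $d(X)$ of a space $X$ is the least cardinality of a dense subset. $\mathfrak{c}=2^\omega$, $\mathfrak{c}^+$ is the successor cardinal of $\mathfrak{c}$, and for an infinite cardinal $\tau$, $\ln\tau$ is the least cardinal $\mu$ with $2^\mu\ge\tau$. $2^{<\mathfrak{c}}=\sup\{2^\mu:\mu<\mathfrak{c}\}$. *)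

(* Defs.v *)
From HB Require Import structures.
From mathcomp Require Import all_boot all_algebra ring_quotient.
From mathcomp Require Import all_classical.
From mathcomp Require Import topology tvs.

Set Implicit Arguments.
Unset Strict Implicit.
Unset Printing Implicit Defensive.

Import GRing.Theory.

Local Open Scope classical_set_scope.
Local Open Scope card_scope.
Local Open Scope ring_scope.

(* Cardinals are represented by types: a type k stands for the cardinality of
   [set: k], so k <= l is [set: k] #<= [set: l], k = l is [set: k] #= [set: l],
   and 2 ^ k is the cardinality of the type k -> bool. Quantifying over all
   cardinals is quantifying over all types of one fixed universe. *)

Definition card_lt (k l : Type) : Prop :=
  [set: k] #<= [set: l] /\ ~ ([set: l] #<= [set: k]).

Definition is_least_card (P : Type -> Prop) (k : Type) : Prop :=
  P k /\ forall l : Type, P l -> [set: k] #<= [set: l].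

(* The least cardinal satisfying P. The default value void is only reached when
   no cardinal satisfies P (least_cardP). *)
Definition least_card (P : Type -> Prop) : Type :=
  if pselect (exists k, is_least_card P k) is left ex then projT1 (cid ex)
  else void.

Lemma card_le_family (I : Type) (X : I -> Type) : I ->
  exists i, forall j, [set: X i] #<= [set: X j].
Proof.
move=> i0.
pose P : set (set (forall i, X i)) :=
  [set S | forall x y, S x -> S y -> forall i, x i = y i -> x = y].
have [|S [PS Smax]] := @Zorn_bigcup _ P.
  move=> F FP totF x y [A FA Ax] [B FB By] i xyi.
  have [AB|BA] := totF _ _ FA FB.
    exact: (FP _ FB _ _ (AB _ Ax) By i).
  exact: (FP _ FA _ _ Ax (BA _ By) i).
have [i surj_i] : exists i, forall a : X i, exists x, S x /\ x i = a.
  apply: contrapT => /forallNP nosurj.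
  have miss i : exists a : X i, forall x, S x -> x i <> a.
    have /existsNP[a /forallNP na] := nosurj i.
    by exists a => x Sx xa; apply: (na x).
  pose f i := projT1 (cid (miss i)).
  have fP i x : S x -> x i <> f i by exact: (projT2 (cid (miss i))).
  apply: (Smax (S `|` [set f])).
    split; first by move=> x Sx; left.
    by move=> /(_ f (or_intror erefl)) Sf; exact: (fP i0 f Sf).
  move=> x y [Sx|->] [Sy|->] j // xy; first exact: (PS _ _ Sx Sy j).
    by case: (fP j x Sx).
  by case: (fP j y Sy).
exists i => j.
pose g a := projT1 (cid (surj_i a)).
have gP a : S (g a) /\ g a i = a by exact: (projT2 (cid (surj_i a))).
have ginj : injective (fun a => g a j).
  move=> a b /= gab; rewrite -(gP a).2 -(gP b).2.
  by rewrite (PS _ _ (gP a).1 (gP b).1 _ gab).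
have : (fun a => g a j) @` [set: X i] #= [set: X i].
  by apply: inj_card_eq => a b _ _; exact: ginj.
rewrite card_eq_le => /andP[_ ge].
exact: card_le_trans ge (subset_card_le (@subsetT _ _)).
Qed.

Lemma least_cardP (P : Type -> Prop) :
  (exists k, P k) -> is_least_card P (least_card P).
Proof.
move=> [K PK].
suff ex : exists k, is_least_card P k.
  rewrite /least_card; case: pselect => // ex'.
  exact: (projT2 (cid ex')).
pose I := {A : set K | exists2 n : Type, P n & A #= [set: n]}.
have IK : exists2 n : Type, P n & [set: K] #= [set: n] by exists K.
have [[A [n Pn An]] minA] :=
  @card_le_family I (fun A => set_type (sval A)) (exist _ [set: K] IK).
have {}minA (B : set K) : (exists2 l : Type, P l & B #= [set: l]) -> A #<= B.
  move=> IB; have /= := minA (exist _ B IB).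
  by rewrite (card_le_eql (card_setT A)) (card_le_eqr (card_setT B)).
exists n; split=> // l Pl; rewrite -(card_le_eql An).
have [] := @card_le_family bool (fun b => if b then K else l) true.
move=> [] /=.
  move=> /(_ false) /= Kl; apply: card_le_trans Kl.
  exact: subset_card_le (@subsetT _ _).
move=> /(_ true) /= /card_subP[B Bl _].
by rewrite -(card_le_eqr Bl); apply: minA; exists l.
Qed.

Definition continuum : Type := nat -> bool.

Definition card_succ (k : Type) : Type := least_card (card_lt k).

Definition card_ln (tau : Type) : Type :=
  least_card (fun mu => [set: tau] #<= [set: mu -> bool]).

(* The supremum of the cardinals 2 ^ mu for mu < k. *)
Definition weak_power2 (k : Type) : Type :=
  least_card (fun s => forall mu : Type,
    card_lt mu k -> [set: mu -> bool] #<= [set: s]).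

Definition density (X : topologicalType) : Type :=
  least_card (fun k => exists2 D : set X, dense D & D #= [set: k]).

Definition precompact_group (G : topologicalZmodType) : Prop :=
  forall U : set G, nbhs (0 : G) U ->
    exists2 F : set G, finite_set F & [set: G] = [set x + u | x in F & u in U].

(* {ideal_quot N} is the library's quotient of a Z-module by any subgroup; no
   ring structure is involved. *)
Definition quotient_group (G : topologicalZmodType) (N : zmodClosed G) : Type :=
  quotient_topology {ideal_quot N}.

Section quotient_group.
Variables (G : topologicalZmodType) (N : zmodClosed G).
Local Notation Q := (quotient_group N).
Local Open Scope quotient_scope.

HB.instance Definition _ := Topological.on Q.
HB.instance Definition _ := Quotient.on Q.
HB.instance Definition _ := @GRing.isZmodule.Build Q
  0 (-%R : {ideal_quot N} -> {ideal_quot N}) (+%R : {ideal_quot N} -> {ideal_quot N} -> {ideal_quot N})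
  (@addrA {ideal_quot N}) (@addrC {ideal_quot N}) (@add0r {ideal_quot N}) (@addNr {ideal_quot N}).

Let pi : G -> Q := \pi_{ideal_quot N}.

Let piB x y : pi (x - y) = pi x - pi y.
Proof. exact: (raddfB (\pi_{ideal_quot N} : {additive G -> {ideal_quot N}})). Qed.

Let pi_nbhs (x : G) (A : set G) : nbhs x A -> nbhs (pi x) (pi @` A).
Proof.
rewrite nbhsE => -[U [oU Ux] UA].
exists (pi @` U); split; first last.
- exact: image_subset UA.
- by exists x.
rewrite /open /= /quotient_open openE => y [z Uz zy].
have : nbhs (y - (y - z)) U by rewrite subKr; exact: open_nbhs_nbhs.
have cst : continuous (fun t : G => t - (y - z)).
  move=> t; apply: (@continuous_comp G (G * G)%type G
    (fun t => (t, y - z)) (fun p => p.1 - p.2)); last exact: tvs.sub_continuous.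
  by apply: cvg_pair; [exact: cvg_id|exact: cvg_cst].
move=> /(cst y) nU; rewrite /interior /mkset.
apply: (@filterS _ (nbhs y) _ _ _ _ nU) => t /= Ut.
exists (t - (y - z)) => //.
by rewrite !piB zy subrr subr0.
Qed.

Let sub_continuous : continuous (fun x : Q * Q => x.1 - x.2).
Proof.
move=> [x y] W /= Wxy.
have piK (u : Q) : pi (repr u) = u by exact: reprK.
have nW : nbhs (repr x - repr y) (pi @^-1` W).
  by apply: pi_continuous; rewrite -/pi piB !piK.
have [[A B] /= [nA nB] AB] := @tvs.sub_continuous G (repr x, repr y) _ nW.
exists (pi @` A, pi @` B) => /=.
  by rewrite -[x]piK -[y]piK; split; exact: pi_nbhs.
move=> [_ _] /= [[a Aa <-] [b Bb <-]]; rewrite -piB.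
exact: (AB (a, b)).
Qed.

HB.instance Definition _ :=
  PreTopologicalNmodule_isTopologicalZmodule.Build Q sub_continuous.

End quotient_group.

(* zmodClosed G is the type of boolean predicates on G that define subgroups;
   classically, every subgroup arises this way. *)
Definition has_small_quotients (k : Type) : Prop :=
  forall G : topologicalZmodType,
    hausdorff_space G -> precompact_group G -> infinite_set [set: G] ->
    exists N : zmodClosed G,
      [/\ closed [set x | x \in N],
          infinite_set [set: quotient_group N] &
          [set: density (quotient_group N)] #<= [set: k]].

Definition quotient_density : Type := least_card has_small_quotients.

(* Main.v *)
Require Import Defs.
From HB Require Import structures.
From mathcomp Require Import Rstruct.
From mathcomp Require Import all_boot all_order all_algebra.
From mathcomp Require Import all_classical reals topology normedtype trigo tvs.
From mathcomp Require Import ring lra.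

Set Implicit Arguments.
Unset Strict Implicit.
Unset Printing Implicit Defensive.

Import Order.TTheory GRing.Theory Num.Theory.
Import numFieldNormedType.Exports.

Local Open Scope classical_set_scope.
Local Open Scope card_scope.
Local Open Scope ring_scope.

(** Upper bound.  In an infinite precompact group [G], neighborhoods [V n] of [0]
    with [V n.+1 - V n.+1] inside [V n], chosen so as to avoid all the
    differences of an infinite sequence, intersect in a closed subgroup [N] of
    infinite index.  Finitely many translates of each [V n] cover [G], so a class
    modulo [N] is determined by a sequence of natural numbers, and the quotient
    has at most continuum many elements ([has_small_quotients_continuum]).

    Lower bound.  Suppose that infinite quotients of density at most [k] always
    exist and that [2 ^ k <= c], where [c] is the continuum.  On a group with a
    dense set of size [k] there are at most
    [c ^ k = (2 ^ k) ^ omega <= c ^ omega = c] continuous characters, so it is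
    enough to find an infinite precompact group each of whose nontrivial quotients
    has more than [c] characters.  Hence [2 ^ k] is not at most [c], that is,
    [c ^+ <= 2 ^ k]; and if [2 ^ mu <= c] for all [mu < c], then [k] is not less
    than [c].

    The group consists of real functions on the set of words in the letters
    [i : continuum -> bool], with the topology of pointwise convergence modulo
    [1].  It is generated by functions [generator F], where [F] is a finite list
    of points of the continuum: their value at a word [w] is a real [theta]
    attached to [F] and to the restrictions to [F] of the letters of [w].  The
    reals [theta] are independent modulo [1] ([indep_realP]): a relation between
    them that holds modulo [1] holds for any elements of any abelian group.

    Let [N] be a proper closed subgroup.  By Kronecker's theorem ([kronecker])
    some integer combination [psi] of coordinates is integral on [N] but not
    everywhere.  By independence, each letter [i] yields another combination
    [prepend i psi] that also vanishes on [N], because the substitution that adds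
    a letter preserves relations ([intcomb_prepend_eq0]).  These characters of
    the quotient are pairwise distinct, because [psi] is not zero and two letters
    that differ at a point [x] are told apart on the generators
    [generator (x :: F)] ([prepend_separated]).  There are [2 ^ c] letters, hence
    more than [c] characters. *)

(** * Distance to the integers *)

Section dist_int.
Variable R : realType.
Implicit Types s t : R.

(** A subadditive even function vanishing exactly on the integers: it defines
    the topology of the circle [R / Z]. *)
Definition dint t : R := `|sin (pi * t)|.

Lemma dint_ge0 t : 0 <= dint t.
Proof. exact: normr_ge0. Qed.

Lemma dint0 : dint 0 = 0.
Proof. by rewrite /dint mulr0 sin0 normr0. Qed.

Lemma dintN t : dint (- t) = dint t.
Proof. by rewrite /dint mulrN sinN normrN. Qed.

Lemma dintB s t : dint (s - t) = dint (t - s).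
Proof. by rewrite -dintN opprB. Qed.

Lemma dintD s t : dint (s + t) <= dint s + dint t.
Proof.
rewrite /dint mulrDr sinD; apply: (le_trans (ler_normD _ _)).
rewrite !normrM; apply: lerD.
  by rewrite ler_piMr // cos_max.
by rewrite ler_piMl // cos_max.
Qed.

Lemma sinD_pi_nat (n : nat) (u : R) : `|sin (u + pi *+ n)| = `|sin u|.
Proof.
elim: n => [|n IHn]; first by rewrite addr0.
by rewrite mulrSr addrA sinDpi normrN.
Qed.

Lemma dintD_int t (m : int) : dint (t + m%:~R) = dint t.
Proof.
have nat_case (n : nat) u : dint (u + n%:R) = dint u.
  by rewrite /dint mulrDr mulr_natr sinD_pi_nat.
case: m => n; first by rewrite -pmulrn nat_case.
by rewrite NegzE mulrNz -pmulrn -(nat_case n.+1 (t - _)) subrK.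
Qed.

Lemma dint_eq0 t : (dint t == 0) = (t \is a Num.int).
Proof.
apply/idP/idP => [|/intrP[m ->]]; last first.
  by rewrite -[m%:~R]add0r dintD_int dint0.
rewrite -[t in dint t](subrK (Num.floor t)%:~R) dintD_int normr_eq0.
have /andP[lo hi] := floor_itv t.
have [<- _|neq /eqP s0] := eqVneq (Num.floor t)%:~R t; first exact: intr_int.
have : 0 < sin (pi * (t - (Num.floor t)%:~R)).
  apply: sin_gt0_pi; rewrite pmulr_rgt0 ?pi_gt0 // subr_gt0 lt_neqAle neq lo /=.
  rewrite -ltr_pdivlMl ?pi_gt0 // mulVf ?gt_eqF ?pi_gt0 //.
  by rewrite intrD in hi; lra.
by rewrite s0 ltxx.
Qed.

Lemma dint_gt0 t : (0 < dint t) = (t \isn't a Num.int).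
Proof. by rewrite lt_neqAle dint_ge0 andbT eq_sym dint_eq0. Qed.

Lemma dintM_int t (m : int) : dint (m%:~R * t) <= `|m|%:~R * dint t.
Proof.
have nat_case (n : nat) : dint (n%:R * t) <= n%:R * dint t.
  elim: n => [|n IHn]; first by rewrite !mul0r dint0.
  rewrite -natr1 !mulrDl !mul1r; apply: (le_trans (dintD _ _)).
  by rewrite lerD2r.
case: m => n; first exact: nat_case.
by rewrite NegzE mulrNz mulNr dintN normrN; exact: nat_case.
Qed.

Lemma cos_dint t : cos (pi *+ 2 * t) = 1 - 2 * dint t ^+ 2.
Proof.
rewrite (mulrnAl pi) cos_mulr2n cos2sin2 /dint real_normK ?num_real //.
by rewrite mulr2n; ring.
Qed.

Lemma dint_near0 (e : R) : 0 < e ->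
  exists2 K : nat, (0 < K)%N & forall t, `|t| < K%:R^-1 -> dint t < e.
Proof.
move=> e0.
have /cvgrPdist_lt /(_ e e0) : sin (pi * t) @[t --> (0 : R)] --> (0 : R).
  rewrite -[X in _ --> X](sin0 R) -[X in _ --> sin X](mulr0 pi).
  apply: (@continuous_comp _ _ _ ( *%R pi) sin); first exact: mulrl_continuous.
  exact: continuous_sin.
move=> /nbhs_ballP[d /= d0 dP].
exists (Num.truncn d^-1).+1 => // t tK; have := dP t.
rewrite sub0r normrN; apply; rewrite /ball /= sub0r normrN.
apply: (lt_le_trans tK); rewrite -[leRHS]invrK lef_pV2 ?posrE ?invr_gt0 //.
by apply/ltW/truncnS_gt.
Qed.

End dist_int.

Section trig_combination.
Variables (R : realType) (W : Type).
Implicit Types (l : seq (int * W)) (x y z : W -> R).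

(** The integer combination of coordinates with coefficients [l]; modulo [1],
    this is a character of the group of all functions [W -> R]. *)
Definition intcomb l y : R := \sum_(p <- l) p.1%:~R * y p.2.

Lemma intcomb_cons (p : int * W) l y :
  intcomb (p :: l) y = p.1%:~R * y p.2 + intcomb l y.
Proof. by rewrite /intcomb big_cons. Qed.

Lemma intcombD l y z : intcomb l (y + z) = intcomb l y + intcomb l z.
Proof.
rewrite /intcomb -big_split; apply: eq_bigr => p _ /=.
by rewrite -mulrDr.
Qed.

Lemma intcombB l y z : intcomb l (y - z) = intcomb l y - intcomb l z.
Proof.
rewrite /intcomb -sumrB; apply: eq_bigr => p _ /=.
by rewrite -mulrBr.
Qed.

End trig_combination.

(** * Kronecker's approximation theorem *)

Section kronecker.
Variables (R : realType) (W : eqType).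
Implicit Types (l : seq (int * W)) (x y z : W -> R) (zs : seq (W -> R)).
Implicit Types (L : seq (seq (int * W))) (ws : seq W).

(** The real part of the character given by [l], translated by [x]. *)
Let wave x l y : R := cos (pi *+ 2 * intcomb l (y - x)).

(** Iterated lazy symmetric averages over the steps [zs]: these operators are
    positive, and the waves are eigenvectors with eigenvalues in [[0, 1]]. *)
Fixpoint average zs (f : (W -> R) -> R) y : R :=
  if zs is z :: zs' then
    (average zs' f y *+ 2 + average zs' f (y + z) + average zs' f (y - z)) / 4
  else f y.

(** The eigenvalue of [average zs] on the waves of frequency [l]. *)
Let damping zs l : R := \prod_(z <- zs) (1 - dint (intcomb l z) ^+ 2).

Lemma damping_cons z zs l :
  damping (z :: zs) l = (1 - dint (intcomb l z) ^+ 2) * damping zs l.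
Proof. by rewrite /damping big_cons. Qed.

Lemma average_wave zs x l y :
  average zs (wave x l) y = damping zs l * wave x l y.
Proof.
elim: zs y => [|z zs IHzs] y; first by rewrite /damping big_nil mul1r.
rewrite /= !IHzs damping_cons /wave.
rewrite !(intcombB l _ x) intcombD (intcombB l y z).
rewrite (addrAC (intcomb l y)) (addrAC (intcomb l y) (- intcomb l z)).
move: (intcomb l y - intcomb l x) => a.
rewrite mulrDr mulrBr cosD cosB (cos_dint (intcomb l z)).
by field.
Qed.

Lemma average_sum zs (A : Type) (s : seq A) (f : A -> (W -> R) -> R) y :
  average zs (fun y => \sum_(i <- s) f i y) y = \sum_(i <- s) average zs (f i) y.
Proof.
elim: zs y => [//|z zs IHzs] y /=; rewrite !IHzs.
by rewrite -sumrMnl -!big_split /= mulr_suml.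
Qed.

Lemma averageZ zs (c : R) (f : (W -> R) -> R) y :
  average zs (fun y => c * f y) y = c * average zs f y.
Proof. by elim: zs y => [//|z zs IHzs] y /=; rewrite !IHzs; field. Qed.

Variable N : set (W -> R).
Hypothesis N0 : N 0.
Hypothesis NB : forall y z, N y -> N z -> N (y - z).

Lemma N_add y z : N y -> N z -> N (y + z).
Proof.
move=> Ny Nz; rewrite -[z]opprK; apply: (NB Ny).
by rewrite -[- z]sub0r; exact: NB.
Qed.

Lemma le_average zs (f g : (W -> R) -> R) y :
    {in zs, forall z, N z} -> (forall z, N z -> f z <= g z) -> N y ->
  average zs f y <= average zs g y.
Proof.
elim: zs y => [|z zs IHzs] y zsN fg Ny /=; first exact: fg.
have Nz : N z by apply: zsN; rewrite mem_head.
have IH t : N t -> average zs f t <= average zs g t.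
  by move=> Nt; apply: IHzs => // u uzs; apply: zsN; rewrite inE uzs orbT.
rewrite ler_pM2r ?invr_gt0 // !lerD ?IH ?lerMn2r //=; first exact: N_add.
exact: NB.
Qed.

Lemma damping_itv zs l : 0 <= damping zs l <= 1.
Proof.
elim: zs => [|z zs /andP[lo hi]]; first by rewrite /damping big_nil ler01 lexx.
have d2 : dint (intcomb l z) ^+ 2 <= 1 by rewrite expr_le1 ?dint_ge0 ?sin_max.
have d0 : 0 <= dint (intcomb l z) ^+ 2 by exact: sqr_ge0.
rewrite damping_cons mulr_ge0 ?mulr_ile1 ?subr_ge0 //.
by rewrite gerBl.
Qed.

Lemma bernoulli_decay (p : R) (J : nat) : 0 <= p -> p <= 1 ->
  (1 + J%:R * p) * (1 - p) ^+ J <= 1.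
Proof.
move=> p0 p1; elim: J => [|J IHJ]; first by rewrite mul0r addr0 mul1r.
apply: le_trans IHJ; rewrite exprS mulrA -natr1.
apply: ler_wpM2r; first by rewrite exprn_ge0 // subr_ge0.
have := ler0n R J; nra.
Qed.

(** Combinations that are trivial on [N] modulo [1]. *)
Let trivial_on l := `[< forall y, N y -> intcomb l y \is a Num.int >].

(** Suitable steps in [N] nearly kill the waves that are not trivial on [N]. *)
Lemma damping_small L (eta : R) : 0 < eta ->
  exists2 zs, {in zs, forall z, N z} &
    {in L, forall l, ~~ trivial_on l -> damping zs l <= eta}.
Proof.
move=> eta0; elim: L => [|l L [zs zsN zsL]]; first by exists [::].
have damping_cat zs' l' : damping (zs' ++ zs) l' = damping zs' l' * damping zs l'.
  by rewrite /damping big_cat.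
have [triv|ntriv] := boolP (trivial_on l).
  exists zs => // l'; rewrite inE => /predU1P[->|]; last exact: zsL.
  by rewrite triv.
have /asboolPn/existsNP[z /not_implyP[Nz /negP nz]] := ntriv.
set p := dint (intcomb l z) ^+ 2.
have p0 : 0 < p by rewrite exprn_gt0 // dint_gt0.
have p1 : p <= 1 by rewrite expr_le1 ?dint_ge0 // sin_max.
pose J := (Num.truncn (eta * p)^-1).+1.
exists (nseq J z ++ zs).
  by move=> t; rewrite mem_cat => /orP[/nseqP[-> //]|]; exact: zsN.
move=> l'; rewrite inE damping_cat => /predU1P[->|/zsL small] nl'; last first.
  apply: le_trans (small nl').
  have /andP[lo _] := damping_itv zs l'.
  by have /andP[_ hi] := damping_itv (nseq J z) l'; exact: ler_piMl.
have -> : damping (nseq J z) l = (1 - p) ^+ J.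
  by rewrite /damping big_nseq iter_mulr_1.
have /andP[lo hi] := damping_itv zs l.
have := bernoulli_decay J (ltW p0) p1.
have Jp : eta^-1 < J%:R * p.
  by rewrite -ltr_pdivrMr // -invfM; exact/truncnS_gt.
have q0 : 0 <= (1 - p) ^+ J by rewrite exprn_ge0 // subr_ge0.
move=> decay.
have : eta^-1 * (1 - p) ^+ J <= 1.
  by apply: le_trans decay; apply: ler_wpM2r => //; lra.
rewrite -ler_pdivlMl ?invr_gt0 // invrK mulr1 => qeta.
by apply: le_trans qeta; exact: ler_piMr.
Qed.

(** The squared modulus of the Dirichlet kernel with [J] terms, that is, [J]
    times the Fejer kernel. *)
Let fejer (J : nat) (u : R) : R :=
  (\sum_(i <- iota 0 J) cos (i%:R * u)) ^+ 2
    + (\sum_(i <- iota 0 J) sin (i%:R * u)) ^+ 2.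

Let square (J : nat) := [seq (i, j) | i <- iota 0 J, j <- iota 0 J].

Lemma fejer_wave J (a u : R) :
  \sum_(p <- square J) cos (a + (p.1%:R - p.2%:R) * u) = cos a * fejer J u.
Proof.
rewrite /square big_allpairs_dep /=.
under eq_bigr do under eq_bigr do rewrite cosD mulrBl cosB sinB.
set C := \sum_(i <- iota 0 J) cos (i%:R * u).
set S := \sum_(i <- iota 0 J) sin (i%:R * u).
transitivity (\sum_(i <- iota 0 J) (cos a * (cos (i%:R * u) * C + sin (i%:R * u) * S)
   - sin a * (sin (i%:R * u) * C - cos (i%:R * u) * S))).
  apply: eq_bigr => i _; rewrite sumrB -!mulr_sumr sumrB big_split /=.
  by rewrite -!mulr_sumr.
rewrite sumrB -!mulr_sumr sumrB big_split /= -!mulr_suml /fejer.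
by rewrite -/C -/S; ring.
Qed.

Lemma fejer_ge0 J u : 0 <= fejer J u.
Proof. by rewrite addr_ge0 ?sqr_ge0. Qed.

Lemma fejer_le J (u : R) : dint u ^+ 2 * fejer J (pi *+ 2 * u) <= 1.
Proof.
set t := pi * u.
have E i : (i%:R * (pi *+ 2 * u) = i%:R * t + i%:R * t :> R).
  by rewrite /t mulr2n; ring.
have tele : sin t * \sum_(i <- iota 0 J) cos (i%:R * (pi *+ 2 * u))
       = sin (J%:R * t) * cos ((J%:R - 1) * t) /\
    sin t * \sum_(i <- iota 0 J) sin (i%:R * (pi *+ 2 * u))
       = sin (J%:R * t) * sin ((J%:R - 1) * t).
  elim: J => [|J [IHc IHs]].
    by rewrite !big_nil !mulr0 !mul0r sin0 !mul0r.
  rewrite -addn1 iotaD !big_cat !big_seq1 /= add0n !mulrDr IHc IHs E.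
  rewrite natrD addrK !mulrBl !mulrDl !mul1r cosB sinB !sinD !cosD.
  have := cos2Dsin2 (J%:R * t); have := cos2Dsin2 t.
  set a := cos _; set b := sin _; set c := cos _; set d := sin _.
  by move=> ab cd; split; [ring: ab cd | ring: ab cd].
have -> : dint u ^+ 2 * fejer J (pi *+ 2 * u) = sin (J%:R * t) ^+ 2.
  rewrite /dint real_normK ?num_real // /fejer mulrDr -!exprMn tele.1 tele.2.
  by rewrite !exprMn -mulrDr cos2Dsin2 mulr1.
by rewrite sin2cos2 gerBl sqr_ge0.
Qed.

(** All the combinations [l + (i - j) w] with [i, j < J], so that summing the
    waves multiplies the sum over [L] by the kernel at coordinate [w]. *)
Let extend J L (w : W) : seq (seq (int * W)) :=
  [seq (p.1%:Z - p.2%:Z, w) :: l | l <- L, p <- square J].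

Let waves x L y : R := \sum_(l <- L) wave x l y.

Lemma waves_extend x J L w y :
  waves x (extend J L w) y = waves x L y * fejer J (pi *+ 2 * (y w - x w)).
Proof.
rewrite /waves big_allpairs_dep mulr_suml /=; apply: eq_bigr => l _.
rewrite /wave -fejer_wave; apply: eq_bigr => p _.
rewrite intcomb_cons /= intrB -!pmulrn; congr cos.
by rewrite (_ : (y - x) w = y w - x w) //; ring.
Qed.

Lemma waves_cat x L L' y : waves x (L ++ L') y = waves x L y + waves x L' y.
Proof. by rewrite /waves big_cat. Qed.

(** The frequencies of the product of the kernels at the coordinates in [ws]. *)
Let full J ws := foldr (fun w L => extend J L w) [:: [::]] ws.

(** The frequencies of the sum, over the coordinates in [ws], of the product of
    the kernels at the other coordinates. *)
Fixpoint punctured J ws :=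
  if ws is w :: ws' then full J ws' ++ extend J (punctured J ws') w else [::].

Lemma waves_full_ge0 x J ws y : 0 <= waves x (full J ws) y.
Proof.
elim: ws => [|w ws IHws] /=; last by rewrite waves_extend mulr_ge0 ?fejer_ge0.
by rewrite /waves big_seq1 /wave /intcomb big_nil mulr0 cos0 ler01.
Qed.

Lemma waves_punctured_ge0 x J ws y : 0 <= waves x (punctured J ws) y.
Proof.
elim: ws => [|w ws IHws] /=; first by rewrite /waves big_nil.
rewrite waves_cat waves_extend.
by rewrite addr_ge0 ?waves_full_ge0 // mulr_ge0 ?fejer_ge0.
Qed.

(** Away from [x] one of the kernels is at most [e ^- 2], hence their product is
    bounded by the sum of the products that omit one kernel. *)
Lemma waves_full_le x J ws y (e : R) :
    0 < e -> (exists2 w, w \in ws & e <= dint (y w - x w)) ->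
  waves x (full J ws) y <= (e ^+ 2)^-1 * waves x (punctured J ws) y.
Proof.
move=> e0; elim: ws => [|w ws IHws] [v]; first by rewrite in_nil.
have e2 : 0 < e ^+ 2 by rewrite exprn_gt0.
rewrite inE => /predU1P off ve /=.
rewrite waves_cat !waves_extend (mulrDr (_^-1)).
have F0 := waves_full_ge0 x J ws y.
have P0 := waves_punctured_ge0 x J ws y.
have K0 := fejer_ge0 J (pi *+ 2 * (y w - x w)).
have e20 : 0 <= (e ^+ 2)^-1 by rewrite invr_ge0 ltW.
case: off => [vw|vws].
  rewrite vw in ve.
  apply: ler_wpDr; first by rewrite !mulr_ge0.
  rewrite [leRHS]mulrC; apply: ler_wpM2l => //.
  rewrite -[leRHS]mulr1 ler_pdivlMl //.
  apply: le_trans (fejer_le J _); apply: ler_wpM2r => //.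
  by rewrite lerXn2r ?nnegrE ?dint_ge0 // ltW.
apply: ler_wpDl; first by rewrite mulr_ge0.
by rewrite mulrA; apply: ler_wpM2r => //; apply: IHws; exists v.
Qed.

(** Only the function represented by a combination matters to [P]. *)
Let extensional (P : pred (seq (int * W))) :=
  forall l l', intcomb l =1 intcomb l' :> ((W -> R) -> R) -> P l = P l'.

Let number (P : pred (seq (int * W))) L : nat := \sum_(l <- L) P l.

Lemma number_cat P L L' : number P (L ++ L') = (number P L + number P L')%N.
Proof. by rewrite /number big_cat. Qed.

Lemma number_extend P J L w :
  number P (extend J L w)
  = (\sum_(p <- square J) number (fun l => P (((p.1%:Z - p.2%:Z)%R, w) :: l)) L)%N.
Proof.
by rewrite /number big_allpairs_dep exchange_big.
Qed.

(* Only the pairs (i, j) with i = j are counted. *)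
Lemma number_full P J ws w : extensional P ->
  (J * number P (full J ws) <= number P (full J (w :: ws)))%N.
Proof.
move=> extP /=; rewrite number_extend /square big_allpairs_dep /=.
have -> : (J * number P (full J ws) = \sum_(i <- iota 0 J) number P (full J ws))%N.
  by rewrite big_const_seq count_predT size_iota iter_addn_0 mulnC.
rewrite !big_seq; apply: leq_sum => i iJ.
rewrite (big_rem i) //= (leq_trans _ (leq_addr _ _)) //.
apply: leq_sum => l _; rewrite subrr.
rewrite (extP ((0, w) :: l) l) // => y.
by rewrite intcomb_cons mul0r add0r.
Qed.

(** Restoring the omitted kernel multiplies the number of trivial frequencies by
    at least [J]. *)
Lemma number_punctured P J ws : extensional P ->
  (J * number P (punctured J ws) <= size ws * number P (full J ws))%N.
Proof.
elim: ws P => [|w ws IHws] P extP; first by rewrite /number big_nil muln0.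
rewrite /= number_cat mulnDr mulSn leq_add //.
  exact: (number_full _ ws w extP).
rewrite !number_extend !big_distrr /=; apply: leq_sum => p _.
apply: IHws => l l' ll'; apply: extP => y.
by rewrite !intcomb_cons ll'.
Qed.

Lemma trivial_on_extensional : extensional trivial_on.
Proof.
by move=> l l' ll'; apply: asbool_equiv_eq; split=> H y /H; rewrite ll'.
Qed.

Lemma number_full_gt0 J ws : (0 < J)%N -> (0 < number trivial_on (full J ws))%N.
Proof.
move=> J0; elim: ws => [|w ws IHws].
  rewrite /number big_seq1 lt0b; apply/asboolP => y _.
  by rewrite /intcomb big_nil int_num0.
apply: leq_trans (number_full J ws w trivial_on_extensional).
by rewrite muln_gt0 J0.
Qed.

(** A point that cannot be approximated by the subgroup [N] of [W -> R] at
    finitely many coordinates modulo [1] is separated from it by an integer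
    combination of coordinates.  Otherwise all the combinations that are trivial
    on [N] are trivial at [x], and averaging a sum of waves over [N] counts, up to
    a small error, its trivial frequencies.  Comparing in this way the product of
    the kernels at the coordinates in [ws] with the products that omit one kernel
    contradicts [number_punctured] when [J] is large. *)
Theorem kronecker x ws (e : R) :
    0 < e -> (forall y, N y -> exists2 w, w \in ws & e <= dint (y w - x w)) ->
  exists2 l, (forall y, N y -> intcomb l y \is a Num.int) &
             intcomb l x \isn't a Num.int.
Proof.
move=> e0 off; apply: contrapT => /forall2NP sep.
have {}sep l : trivial_on l -> intcomb l x \is a Num.int.
  by move=> /asboolP tl; have [/(_ tl)|/negP/negPn] := sep l.
have e2 : 0 < e ^+ 2 by rewrite exprn_gt0.
(* With this J, the trivial frequencies of the punctured products, weighted by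
   e ^- 2, are at most half as many as those of the full product. *)
pose J := (Num.truncn ((size ws).*2%:R / e ^+ 2)).+1.
have HJ : (size ws).*2%:R < J%:R * e ^+ 2.
  by rewrite -ltr_pdivrMr //; exact: truncnS_gt.
pose F := full J ws; pose P := punctured J ws.
have MF : (1 <= number trivial_on F)%N by exact: number_full_gt0.
have MP := number_punctured J ws trivial_on_extensional.
rewrite -/F -/P in MP.
pose c := (e ^+ 2)^-1.
have c0 : 0 < c by rewrite invr_gt0.
pose eta := (4 * ((size F)%:R + c * (size P)%:R + 1))^-1.
have den0 : 0 < (size F)%:R + c * (size P)%:R + 1 :> R.
  by rewrite ltr_wpDl // addr_ge0 ?mulr_ge0 // ltW.
have eta0 : 0 < eta by rewrite invr_gt0 mulr_gt0.
have [zs zsN small] := damping_small (F ++ P) eta0.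
(* Averaging the waves over N counts the trivial frequencies. *)
have near_number L : {subset L <= F ++ P} ->
    `|average zs (waves x L) 0 - (number trivial_on L)%:R| <= eta * (size L)%:R.
  move=> LFP; rewrite average_sum /number natr_sum -sumrB.
  apply: (le_trans (ler_norm_sum _ _ _)).
  rewrite -sum1_size natr_sum mulr_sumr big_seq [leRHS]big_seq.
  apply: ler_sum => l lL; rewrite average_wave mulr1.
  have [triv|ntriv] := boolP (trivial_on l); last first.
    rewrite subr0 normrM ger0_norm; last by case/andP: (damping_itv zs l).
    apply: le_trans (small l (LFP _ lL) ntriv).
    by rewrite ler_piMr ?cos_max //; case/andP: (damping_itv zs l).
  have -> : damping zs l = 1.
    rewrite /damping big_seq big1 // => z /zsN Nz.
    have /asboolP/(_ z Nz) := triv.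
    by rewrite -dint_eq0 => /eqP ->; rewrite expr0n subr0.
  rewrite mul1r /wave cos_dint intcombB.
  have -> : dint (intcomb l 0 - intcomb l x) = 0.
    apply/eqP; rewrite dint_eq0 rpredB ?sep //.
    by have /asboolP/(_ 0 N0) := triv.
  by rewrite expr0n mulr0 subr0 subrr normr0 ltW.
have : average zs (waves x F) 0 <= c * average zs (waves x P) 0.
  rewrite -averageZ; apply: le_average => // z Nz.
  by apply: waves_full_le => //; exact: off.
have := near_number P; have := near_number F.
have subF : {subset F <= F ++ P} by move=> l lF; rewrite mem_cat lF.
have subP : {subset P <= F ++ P} by move=> l lP; rewrite mem_cat lP orbT.
move=> /(_ subF)/ler_normlP[nF _] /(_ subP)/ler_normlP[_ nP] FP.
set AF := average zs _ 0 in nF FP; set AP := average zs _ 0 in nP FP.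
have cMP : c * (number trivial_on P)%:R <= (number trivial_on F)%:R / 2.
  rewrite /c ler_pdivrMl //.
  have J0 : 0 < J%:R :> R by rewrite ltr0n.
  rewrite -(ler_pM2l J0) -natrM.
  apply: (@le_trans _ _ (size ws * number trivial_on F)%:R).
    by rewrite ler_nat.
  rewrite natrM mulrCA [leRHS]mulrC -mulrA.
  have MF0 : 0 <= (number trivial_on F)%:R :> R by exact: ler0n.
  move: HJ; rewrite -muln2 natrM; nra.
have MF1 : 1 <= (number trivial_on F)%:R :> R by rewrite ler1n.
have eta4 : eta * ((size F)%:R + c * (size P)%:R + 1) = 1 / 4.
  by rewrite /eta invfM -mulrA mulVf ?gt_eqF // mulr1 mul1r.
have cnP : c * (AP - (number trivial_on P)%:R) <= c * (eta * (size P)%:R).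
  by rewrite ler_pM2l.
have ec : c * (eta * (size P)%:R) = eta * (c * (size P)%:R) by ring.
rewrite mulrBr ec in cnP; rewrite !mulrDr mulr1 in eta4; lra.
Qed.

End kronecker.
(** * An independent family of reals indexed by the continuum *)

Section factorial_series.
Variable R : realType.
Implicit Types A : pred nat.

Definition factorial_partial A (m : nat) : R :=
  \sum_(0 <= n < m) (A n)%:R / n`!%:R.

(** The sum of the series of the [1 / n!] with [A n]. *)
Definition factorial_series A : R := sup (range (factorial_partial A)).

Lemma factorial_partialS A m :
  factorial_partial A m.+1 = factorial_partial A m + (A m)%:R / m`!%:R.
Proof. by rewrite /factorial_partial big_nat_recr. Qed.

Lemma factorial_partial_le A c m : (0 < c)%N ->
  factorial_partial A m <= factorial_partial A c.+1 + (c%:R * c`!%:R)^-1.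
Proof.
move=> c0.
have mono : {homo factorial_partial A : m n / (m <= n)%N >-> m <= n}.
  apply: homo_leq => [//|u v w|n]; first exact: le_trans.
  by rewrite factorial_partialS lerDl mulr_ge0 ?invr_ge0 ?ler0n.
apply: (@le_trans _ _ (factorial_partial A (c.+1 + m))).
  by apply: mono; rewrite leq_addl.
(* The bound telescopes: 1 / (n + 1)! is at most the difference of the bounds
   at n and n + 1. *)
have step : factorial_partial A (c.+1 + m) <=
    factorial_partial A c.+1 + (c%:R * c`!%:R)^-1
      - ((c + m)%:R * (c + m)`!%:R)^-1.
  elim: m => [|m IHm]; first by rewrite !addn0 addrK.
  rewrite !addnS factorial_partialS addSn; set n := (c + m)%N in IHm *.
  have n0 : 0 < n%:R :> R by rewrite ltr0n addn_gt0 c0.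
  have f0 : 0 < n`!%:R :> R by rewrite ltr0n fact_gt0.
  have -> : (n.+1)`!%:R = (n%:R + 1) * n`!%:R :> R by rewrite factS natrM natr1.
  rewrite -natr1.
  have An : (A n.+1)%:R / ((n%:R + 1) * n`!%:R) <= ((n%:R + 1) * n`!%:R)^-1 :> R.
    rewrite ler_piMl ?invr_ge0 ?mulr_ge0 ?addr_ge0 ?ler0n //.
    by case: (A _); rewrite ?ler01.
  have tail : ((n%:R + 1) * n`!%:R)^-1 <=
      (n%:R * n`!%:R)^-1 - ((n%:R + 1) * ((n%:R + 1) * n`!%:R))^-1 :> R.
    rewrite -subr_ge0.
    have -> : (n%:R * n`!%:R)^-1 - ((n%:R + 1) * ((n%:R + 1) * n`!%:R))^-1
        - ((n%:R + 1) * n`!%:R)^-1 = (n%:R * (n%:R + 1) ^+ 2 * n`!%:R)^-1 :> R.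
      by field; rewrite ?gt_eqF // ltr_wpDl // ltW.
    by rewrite invr_ge0 !mulr_ge0 ?exprn_ge0 ?addr_ge0 // ltW.
  by move: IHm An tail; lra.
by apply: (le_trans step); rewrite gerBl invr_ge0 mulr_ge0 ?ler0n.
Qed.

Lemma factorial_series_ge A m : factorial_partial A m <= factorial_series A.
Proof.
apply: sup_upper_bound; last by exists m.
split; first by exists (factorial_partial A 0%N); exists 0%N.
by exists (factorial_partial A 2 + (1 * 1`!%:R)^-1) => _ [n _ <-];
  exact: factorial_partial_le.
Qed.

Lemma factorial_series_le A c : (0 < c)%N ->
  factorial_series A <= factorial_partial A c.+1 + (c%:R * c`!%:R)^-1.
Proof.
move=> c0; apply: ge_sup; first by exists (factorial_partial A 0%N); exists 0%N.
by move=> _ [n _ <-]; exact: factorial_partial_le.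
Qed.

Lemma factorial_partial_int A m : m`!%:R * factorial_partial A m.+1 \is a Num.int.
Proof.
elim: m => [|m IHm].
  rewrite factorial_partialS /factorial_partial big_geq //.
  by rewrite add0r divr1 mul1r natr_int.
rewrite factorial_partialS mulrDr rpredD //.
  by rewrite factS natrM -mulrA rpredM ?natr_int.
by rewrite mulrCA divff ?mulr1 ?natr_int // pnatr_eq0 -lt0n fact_gt0.
Qed.

(** At a large index [c] that belongs to the sets of the terms in [D] and to no
    other, [(c - 1)!] times the combination is an integer plus [C / c], up to
    [O(1 / c ^ 2)], where [C] is the sum of the coefficients of the terms in
    [D]. *)
Lemma factorial_series_comb (T : eqType) (A : T -> pred nat) (D : pred T)
    (l : seq (int * T)) :
    (forall B : nat, exists2 c, (B < c)%N & all (fun p => A p.2 c == D p.2) l) ->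
    \sum_(p <- l) p.1%:~R * factorial_series (A p.2) \is a Num.int ->
  \sum_(p <- l | D p.2) p.1 = 0.
Proof.
move=> large l_int.
pose M : R := \sum_(p <- l) `|p.1%:~R|.
have M0 : 0 <= M by apply: sumr_ge0 => p _; exact: normr_ge0.
have [[//|c] Bc /allP Ac] := large (Num.truncn (2 * M)).
have cM : 2 * M < c.+1%:R.
  by apply: (lt_le_trans (truncnS_gt _)); rewrite ler_nat.
have c0 : 0 < c.+1%:R :> R by rewrite ltr0n.
have f0 : 0 < c`!%:R :> R by rewrite ltr0n fact_gt0.
pose r (p : int * T) : R :=
  factorial_series (A p.2) - factorial_partial (A p.2) c.+2.
have r_itv (p : int * T) : 0 <= r p <= (c.+1%:R * (c.+1)`!%:R)^-1.
  by rewrite subr_ge0 factorial_series_ge lerBlDl factorial_series_le.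
pose C : int := \sum_(p <- l | D p.2) p.1.
pose e := c`!%:R * \sum_(p <- l) p.1%:~R * r p.
have e_le : `|e| <= M / c.+1%:R ^+ 2.
  rewrite /e normrM gtr0_norm // mulrC -ler_pdivlMr //.
  apply: (le_trans (ler_norm_sum _ _ _)).
  rewrite /M !mulr_suml; apply: ler_sum => p _.
  rewrite normrM -!mulrA; apply: ler_wpM2l => //.
  have /andP[r0 r1] := r_itv p; rewrite ger0_norm //; apply: (le_trans r1).
  by rewrite factS natrM -invfM expr2 mulrA.
have CM : `|C%:~R| <= M :> R.
  rewrite /C rmorph_sum /= /M [leRHS](bigID (fun p => D p.2)) /=.
  apply: (le_trans (ler_norm_sum _ _ _)); rewrite lerDl.
  by apply: sumr_ge0 => p _; exact: normr_ge0.
have v_int : C%:~R / c.+1%:R + e \is a Num.int.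
  have E : c`!%:R * (\sum_(p <- l) p.1%:~R * factorial_series (A p.2))
      = \sum_(p <- l) p.1%:~R * (c`!%:R * factorial_partial (A p.2) c.+1)
        + (C%:~R / c.+1%:R + e).
    rewrite /e /C !rmorph_sum /= !mulr_sumr mulr_suml (big_mkcond (fun p => D _)) /=.
    rewrite -!big_split /= !big_seq; apply: eq_bigr => p pl.
    rewrite /r (factorial_partialS _ c.+1) (eqP (Ac p pl)) factS natrM.
    move: (gt_eqF c0) (gt_eqF f0) => /negbT k0 /negbT u0.
    move: (c.+1%:R) (c`!%:R) k0 u0 => k u k0 u0.
    by case: (D p.2) => /=; field; rewrite ?k0 ?u0.
  rewrite -[_ + e](addKr
    (\sum_(p <- l) p.1%:~R * (c`!%:R * factorial_partial (A p.2) c.+1))).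
  rewrite -E addrC rpredB //; first by rewrite rpredM ?natr_int.
  by apply: rpred_sum => p _; rewrite rpredM ?intr_int ?factorial_partial_int.
have Cc : `|C%:~R / c.+1%:R| <= M / c.+1%:R :> R.
  by rewrite normrM normfV (gtr0_norm c0) ler_wpM2r // invr_ge0 ltW.
have Mc : M / c.+1%:R < 1 / 2 by rewrite ltr_pdivrMr //; lra.
have Mcc : M / c.+1%:R ^+ 2 <= M / c.+1%:R.
  rewrite ler_wpM2l // lef_pV2 ?posrE ?exprn_gt0 //.
  by rewrite expr2 ler_peMr ?ler1n // ltW.
have v0 : C%:~R / c.+1%:R + e = 0.
  have : `|C%:~R / c.+1%:R + e| < 1.
    apply: (le_lt_trans (ler_normD _ _)); rewrite [ltRHS]splitr ltrD //.
      exact: le_lt_trans Cc Mc.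
    exact: le_lt_trans (le_trans e_le Mcc) Mc.
  case/intrP: v_int => m ->; rewrite -intr_norm ltrz1 -abszE.
  by rewrite ltz_nat ltnS leqn0 absz_eq0 => /eqP ->.
have : `|C%:~R| < 1 :> R.
  have -> : C%:~R = - (c.+1%:R * e) :> R.
    apply: (mulIf (x := c.+1%:R^-1)); first by rewrite gt_eqF ?invr_gt0.
    rewrite mulNr (mulrC c.+1%:R) mulfK ?gt_eqF //.
    by apply/eqP; rewrite -addr_eq0 v0.
  rewrite normrN normrM (gtr0_norm c0).
  apply: (@le_lt_trans _ _ (c.+1%:R * (M / c.+1%:R ^+ 2))).
    by rewrite ler_wpM2l // ltW.
  rewrite expr2 invfM mulrCA mulVKf ?gt_eqF //.
  by apply: (lt_trans Mc); rewrite mul1r invf_lt1 ?ltr1n.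
by rewrite -intr_norm ltrz1 -abszE ltz_nat ltnS leqn0 absz_eq0 => /eqP.
Qed.

End factorial_series.

(** The codes of the finite prefixes of [x]; these sets are almost disjoint. *)
Definition prefix_codes (x : nat -> bool) : pred nat :=
  fun n => if unpickle n is Some s then s == mkseq x (size s) else false.

Lemma prefix_codesE x (s : seq bool) :
  prefix_codes x (pickle s) = (s == mkseq x (size s)).
Proof. by rewrite /prefix_codes pickleK. Qed.

Lemma prefix_codes_separated (x : nat -> bool) (ys : seq (nat -> bool)) (B : nat) :
  exists2 c, (B < c)%N & {in ys, forall y, prefix_codes y c = (y == x)}.
Proof.
have [K HK] : exists K, forall k, (K <= k)%N ->
    {in ys, forall y, (mkseq x k == mkseq y k) = (y == x)}.
  elim: ys => [|y ys [K HK]]; first by exists 0%N.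
  have [n xy] : exists n, y != x -> x n != y n.
    have [_|yx] := eqVneq y x; first by exists 0%N.
    have [eq|/existsNP[n /eqP xy]] := pselect (forall n, x n = y n);
      last by exists n.
    by case/eqP: yx; apply/funext.
  exists (maxn K n.+1) => k; rewrite geq_max => /andP[Kk nk] z.
  rewrite inE => /predU1P[->|]; last exact: HK.
  have [->|yx] := eqVneq y x; first exact: eqxx.
  apply/negP => /eqP /(congr1 (nth false ^~ n)).
  by rewrite !nth_mkseq // => /eqP; apply/negP; exact: xy.
have inj : injective (fun k => pickle (mkseq x (K + k))).
  move=> j k /(pcan_inj pickleK) /(congr1 size).
  by rewrite !size_mkseq => /addnI.
have [k Bk] := injective_gtn inj B.
exists (pickle (mkseq x (K + k))) => // y ys_y.
by rewrite prefix_codesE size_mkseq HK // leq_addr.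
Qed.

Section independence.
Variables (R : realType) (T : eqType) (code : T -> nat -> bool).
Hypothesis code_inj : injective code.

(** The real attached to [t]: the sum of the [1 / n!] over the codes [n] of the
    prefixes of [code t]. *)
Definition indep_real (t : T) : R := factorial_series R (prefix_codes (code t)).

Lemma sum_fibers0 (V : zmodType) (l : seq (int * T)) (g : T -> V) :
    (forall x, \sum_(p <- l | code p.2 == x) p.1 = 0) ->
  \sum_(p <- l) g p.2 *~ p.1 = 0.
Proof.
have [n] := ubnP (size l); elim: n l => // n IHn [|p l] ln l0.
  by rewrite big_nil.
set D := fun q : int * T => code q.2 == code p.2.
rewrite (bigID D) /=.
have -> : \sum_(q <- p :: l | D q) g q.2 *~ q.1
    = g p.2 *~ (\sum_(q <- p :: l | D q) q.1).
  by rewrite mulrz_sumr; apply: eq_bigr => q /eqP /code_inj ->.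
rewrite (l0 (code p.2)) mulr0z add0r -big_filter; apply: IHn.
  rewrite size_filter /= /D eqxx /= add0n.
  by move: ln; rewrite ltnS; apply: leq_ltn_trans (count_size _ _).
move=> x; rewrite big_filter_cond.
have [->|xp] := eqVneq x (code p.2).
  by rewrite big_pred0 // => q; rewrite andNb.
rewrite -[RHS](l0 x); apply: eq_bigl => q.
have [qx|] := eqVneq (code q.2) x; last by rewrite andbF.
by rewrite andbT /D qx.
Qed.

(** Relations modulo [1] between the members of the family hold between any
    elements of any abelian group. *)
Lemma indep_realP (V : zmodType) (l : seq (int * T)) (g : T -> V) :
    \sum_(p <- l) p.1%:~R * indep_real p.2 \is a Num.int ->
  \sum_(p <- l) g p.2 *~ p.1 = 0.
Proof.
move=> l_int; apply: sum_fibers0 => x.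
apply: (factorial_series_comb (R := R) (A := fun t => prefix_codes (code t))
  (D := fun t => code t == x)) l_int => B.
have [c Bc Hc] := prefix_codes_separated x [seq code p.2 | p <- l] B.
exists c => //; apply/allP => p pl; apply/eqP/Hc.
by apply/mapP; exists p.
Qed.

End independence.

(** * Precompact groups of functions modulo [1] *)

(** A group of real functions on [W], with the topology of pointwise convergence
    modulo [1]. *)
Record bohr_group (R : realType) (W : choiceType) (P : zmodClosed (W -> R)) :=
  BohrGroup { bohr_val :> W -> R; _ : bohr_val \in P }.

Section bohr_group.
Variables (R : realType) (W : choiceType) (P : zmodClosed (W -> R)).
Local Notation G := (bohr_group P).

HB.instance Definition _ := [isSub for @bohr_val R W P].
HB.instance Definition _ := [Choice of G by <:].
HB.instance Definition _ := [SubChoice_isSubZmodule of G by <:].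

Implicit Types x y z : G.

Lemma bohrB x y w : bohr_val (x - y) w = x w - y w.
Proof. by []. Qed.

(** The basic neighborhoods of [x]. *)
Definition bohr_near x (ws : seq W) (e : R) : set G :=
  [set y | {in ws, forall w, dint (y w - x w) < e}].

Definition bohr_nbhs x : set_system G :=
  [set A | exists ws, exists2 e, 0 < e & bohr_near x ws e `<=` A].

HB.instance Definition _ := hasNbhs.Build G bohr_nbhs.

Lemma bohr_near_nbhs x ws e : 0 < e -> nbhs x (bohr_near x ws e).
Proof. by move=> e0; exists ws, e. Qed.

Let nbhs_filter x : ProperFilter (nbhs x).
Proof.
have near_refl ws e : 0 < e -> bohr_near x ws e x.
  by move=> e0 w _; rewrite subrr dint0.
apply: Build_ProperFilter_ex.
  by move=> A [ws [e e0 sA]]; exists x; apply/sA/near_refl.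
split.
- by exists [::], 1.
- move=> A B [wsA [eA eA0 sA]] [wsB [eB eB0 sB]].
  exists (wsA ++ wsB), (Num.min eA eB); first by rewrite lt_min eA0.
  move=> y Hy; split.
    apply: sA => w wA; have := Hy w; rewrite mem_cat wA lt_min.
    by move=> /(_ isT)/andP[].
  apply: sB => w wB; have := Hy w; rewrite mem_cat wB orbT lt_min.
  by move=> /(_ isT)/andP[].
- move=> A B AB [ws [e e0 sA]]; exists ws, e => //.
  exact: subset_trans AB.
Qed.

Let nbhs_singleton x (A : set G) : nbhs x A -> A x.
Proof.
by move=> [ws [e e0 sA]]; apply: sA => w _; rewrite subrr dint0.
Qed.

Let half_near x y z ws (e : R) : bohr_near x ws (e / 2) y ->
  bohr_near y ws (e / 2) z -> bohr_near x ws e z.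
Proof.
move=> xy yz w wws; rewrite (splitr e).
rewrite (_ : z w - x w = (z w - y w) + (y w - x w)); last by rewrite addrA subrK.
by apply: (le_lt_trans (dintD _ _)); rewrite ltrD ?xy ?yz.
Qed.

Let nbhs_nbhs x (A : set G) : nbhs x A -> nbhs x (nbhs^~ A).
Proof.
move=> [ws [e e0 sA]]; exists ws, (e / 2); first by rewrite divr_gt0.
move=> y xy; exists ws, (e / 2); first by rewrite divr_gt0.
by move=> z yz; apply: sA; exact: half_near xy yz.
Qed.

HB.instance Definition _ :=
  Nbhs_isNbhsTopological.Build G nbhs_filter nbhs_singleton nbhs_nbhs.

Let sub_continuous : continuous (fun x : G * G => x.1 - x.2).
Proof.
move=> [x y] A /= [ws [e e0 sA]].
exists (bohr_near x ws (e / 2), bohr_near y ws (e / 2)).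
  by split; apply: bohr_near_nbhs; rewrite divr_gt0.
move=> [x' y'] /= [xx' yy']; apply: sA => w wws.
rewrite !bohrB.
rewrite (_ : _ - _ = (x' w - x w) - (y' w - y w)); last by ring.
rewrite (splitr e); apply: (le_lt_trans (dintD _ _)).
by rewrite dintN ltrD ?xx' ?yy'.
Qed.

HB.instance Definition _ :=
  PreTopologicalNmodule_isTopologicalZmodule.Build G sub_continuous.

Lemma bohr_hausdorff :
    (forall y, (forall w, y w \is a Num.int) -> y = 0) ->
  hausdorff_space G.
Proof.
move=> int0 x y xy; apply/eqP; rewrite -subr_eq0; apply/eqP/int0 => w.
rewrite -dint_eq0; apply/negPn/negP => d_neq0.
have d0 : 0 < dint (bohr_val (x - y) w) by rewrite lt_neqAle dint_ge0 eq_sym d_neq0.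
have d2 : 0 < dint (bohr_val (x - y) w) / 2 by rewrite divr_gt0.
have [z [/(_ w) xz /(_ w) yz]] := xy _ _
  (bohr_near_nbhs x [:: w] d2) (bohr_near_nbhs y [:: w] d2).
move: (xz (mem_head _ _)) (yz (mem_head _ _)); rewrite dintB => xz' yz'.
have := ltrD xz' yz'; rewrite -splitr ltNge => /negP; apply.
rewrite bohrB (_ : x w - y w = (x w - z w) + (z w - y w)); first exact: dintD.
by rewrite addrA subrK.
Qed.

Lemma bohr_precompact : precompact_group G.
Proof.
move=> U [ws [e e0 sU]].
have [K K0 HK] := dint_near0 e0.
(* Points are sorted according to the K-adic bins of the fractional parts of their
   coordinates in ws. *)
pose frac (t : R) : R := t - (Num.floor t)%:~R.
have frac_itv t : 0 <= frac t < 1.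
  by have /andP[lo hi] := floor_itv t; rewrite /frac; rewrite intrD in hi; lra.
have nonneg t : 0 <= K%:R * frac t.
  by rewrite mulr_ge0 ?ler0n //; case/andP: (frac_itv t).
pose bin (t : R) : 'I_K.+1 := inord (Num.truncn (K%:R * frac t)).
have binP s t : bin s = bin t -> dint (s - t) < e.
  move=> st.
  have trunc_lt u : (Num.truncn (K%:R * frac u) < K.+1)%N.
    have /andP[lo hi] := frac_itv u.
    have K0' : 0 < K%:R :> R by rewrite ltr0n.
    have le_u : (Num.truncn (K%:R * frac u))%:R <= K%:R * frac u.
      by rewrite truncn_le.
    rewrite ltnS -(ler_nat R); apply: (le_trans le_u).
    by rewrite ler_piMr // ltW.
  have {st} E : Num.truncn (K%:R * frac s) = Num.truncn (K%:R * frac t).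
    by have /(congr1 val) := st; rewrite /= !inordK.
  have -> : s - t = (frac s - frac t) + (Num.floor s - Num.floor t)%:~R.
    by rewrite /frac intrB; ring.
  rewrite dintD_int; apply: HK.
  have K0' : 0 < K%:R :> R by rewrite ltr0n.
  rewrite -[ltRHS]mul1r ltr_pdivlMr // mulrC -{1}(gtr0_norm K0') -normrM mulrBr.
  have /andP[s1 s2] := truncn_itv (nonneg s).
  have /andP[t1 t2] := truncn_itv (nonneg t).
  by rewrite E in s1 s2; rewrite -natr1 in s2 t2; rewrite ltr_norml; lra.
pose bins x := [tuple of map (fun w => bin (x w)) (in_tuple ws)].
pose pick_bin t : G := xget 0 [set x | bins x = t].
exists (pick_bin @` setT); first exact/finite_image/finite_finset.
apply/seteqP; split=> // x _.
exists (pick_bin (bins x)); first by exists (bins x).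
exists (x - pick_bin (bins x)); last by rewrite addrC subrK.
have : bins (pick_bin (bins x)) = bins x.
  by apply: (@xgetPex _ 0 [set z | bins z = bins x]); exists x.
move=> /(congr1 val) /= /eq_in_map E; apply: sU => w wws.
by rewrite subr0 bohrB; apply/binP; rewrite E.
Qed.

End bohr_group.

(** * Cardinal comparisons *)

Lemma card_le_injP (A B : Type) :
  [set: A] #<= [set: B] <-> exists f : A -> B, injective f.
Proof.
split=> [/card_leP[f]|[f finj]].
  exists (fun a => set_val (f (SigSub (mem_set (I : [set: A] a))))).
  move=> a b /val_inj fab.
  by have /= [] := inj (in_setT _) (in_setT _) fab.
have : f @` [set: A] #= [set: A] by apply: inj_card_eq => a b _ _; exact: finj.
rewrite card_eq_le => /andP[_ le].
exact: card_le_trans le (subset_card_le (@subsetT _ _)).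
Qed.

Lemma card_le_total (A B : Type) : [set: A] #<= [set: B] \/ [set: B] #<= [set: A].
Proof.
have [[] min] := @card_le_family bool (fun b => if b then A else B) true.
  by left; exact: (min false).
by right; exact: (min true).
Qed.

Lemma cantor_power (T : Type) : ~ ([set: T -> bool] #<= [set: T]).
Proof.
move=> /card_le_injP[h hinj].
pose A t : bool := `[< exists2 B : T -> bool, h B = t & ~~ B t >].
have [AhA|nAhA] := boolP (A (h A)).
  have /asboolP[B /hinj -> ] := AhA.
  by rewrite AhA.
by case/asboolP: (nAhA); exists A.
Qed.

Lemma le_power2 (A B : Type) :
  [set: A] #<= [set: B] -> [set: A -> bool] #<= [set: B -> bool].
Proof.
move=> /card_le_injP[f finj]; apply/card_le_injP.
exists (fun (P : A -> bool) b => `[< exists2 a, f a = b & P a >]) => P Q PQ.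
apply/funext => a; have /(congr1 (fun S => S (f a))) := PQ.
have E (S : A -> bool) : `[< exists2 a', f a' = f a & S a' >] = S a.
  by apply/asboolP/idP => [[a' /finj ->]|Sa] //; exists a.
by rewrite !E.
Qed.

Lemma continuum_seq (C : Type) : [set: C] #<= [set: continuum] ->
  [set: nat -> C] #<= [set: continuum].
Proof.
move=> /card_le_injP[f finj]; apply/card_le_injP.
exists (fun u n =>
  if @unpickle (nat * nat)%type n is Some p then f (u p.1) p.2 else false).
move=> u v uv; apply/funext => n; apply/finj/funext => m.
by have /(congr1 (fun x => x (pickle (n, m)))) := uv; rewrite pickleK.
Qed.

(* A real number is coded by the rational numbers below it. *)
Lemma real_le_continuum (R : realType) : [set: R] #<= [set: continuum].
Proof.
apply/card_le_injP.
exists (fun x n => if @unpickle rat n is Some q then ratr q < x else false).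
suff lt_neq (x y : R) : x < y ->
    (fun n => if @unpickle rat n is Some q then ratr q < x else false) <>
    (fun n => if @unpickle rat n is Some q then ratr q < y else false).
  by move=> x y xy; have [/lt_neq|/lt_neq /nesym|] := ltgtP x y.
move=> xy; have [q] := rat_in_itvoo xy.
rewrite in_itv /= => /andP[xq qy] /(congr1 (fun u => u (pickle q))).
by rewrite pickleK qy ltNge ltW.
Qed.

Lemma not_card_le k l : ~ ([set: k] #<= [set: l]) -> card_lt l k.
Proof. by move=> nkl; split=> //; have [] := card_le_total k l. Qed.

Lemma densityP (X : topologicalType) :
  is_least_card (fun k => exists2 D : set X, dense D & D #= [set: k]) (density X).
Proof.
apply: least_cardP; exists X, [set: X]; last exact: card_eqxx.
by move=> O O0 _; rewrite setIT.
Qed.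

Lemma density_le (X : topologicalType) : [set: density X] #<= [set: X].
Proof.
apply: (densityP X).2; exists [set: X]; last exact: card_eqxx.
by move=> O O0 _; rewrite setIT.
Qed.

(** * A group with no small quotients *)

Section large_group.
Variable R : realType.

(* A node is a finite list of points of the continuum with a finite list of Boolean
   patterns on these points. *)
Local Notation node := (seq continuum * seq (seq bool))%type.

Definition node_code (s : node) : nat -> bool := fun n =>
  match @unpickle (nat * nat + nat * seq (seq bool))%type n with
  | Some (inl p) => nth (fun=> false) s.1 p.1 p.2
  | Some (inr p) => (p.1 == size s.1) && (p.2 == s.2)
  | None => false
  end.

Lemma node_code_inj : injective node_code.
Proof.
move=> [F l] [F' l'] E.
have En n : node_code (F, l) n = node_code (F', l') n by rewrite E.
have := En (pickle (inr (size F, l) : (nat * nat + nat * seq (seq bool))%type)).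
rewrite /node_code !pickleK /= !eqxx => /esym/andP[/eqP sz /eqP <-].
congr (_, _); apply: (@eq_from_nth _ (fun=> false)) => // j _.
apply/funext => k.
have := En (pickle (inl (j, k) : (nat * nat + nat * seq (seq bool))%type)).
by rewrite /node_code !pickleK.
Qed.

(** An independent family of real numbers indexed by the nodes. *)
Definition theta (s : node) : R := indep_real R node_code s.

Lemma thetaP (V : zmodType) (r : seq (int * node)) (g : node -> V) :
    \sum_(p <- r) p.1%:~R * theta p.2 \is a Num.int ->
  \sum_(p <- r) g p.2 *~ p.1 = 0.
Proof. exact: indep_realP node_code_inj _ _ _. Qed.

(** The coordinates are indexed by words whose letters are the subsets of the
    continuum. *)
Definition word : choiceType := seq (continuum -> bool).

(** The restrictions to [F] of the letters of [w]. *)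
Definition pattern (F : seq continuum) (w : word) : seq (seq bool) :=
  [seq [seq i x | x <- F] | i <- w].

Definition generator (F : seq continuum) : word -> R :=
  fun w => theta (F, pattern F w).

(** Membership in the subgroup generated by the functions [generator F]. *)
Definition generated : {pred word -> R} := fun y =>
  `[< exists l : seq (int * seq continuum),
        forall w, y w = \sum_(p <- l) p.1%:~R * generator p.2 w >].

Lemma generated_zmod_closed : zmod_closed generated.
Proof.
split=> [|y z /asboolP[l Hl] /asboolP[m Hm]].
  by apply/asboolP; exists [::] => w; rewrite big_nil.
apply/asboolP; exists (l ++ [seq (- p.1, p.2) | p <- m]) => w.
rewrite big_cat big_map /= -Hl [LHS]/(y w - z w) Hm -sumrN; congr (_ + _).
by apply: eq_bigr => p _; rewrite mulrNz mulNr.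
Qed.

HB.instance Definition _ :=
  GRing.isZmodClosed.Build (word -> R) generated generated_zmod_closed.

Lemma generator_in F : generator F \in generated.
Proof. by apply/asboolP; exists [:: (1, F)] => w; rewrite big_seq1 mul1r. Qed.

Implicit Types (psi : seq (int * word)) (y : word -> R) (i j : continuum -> bool).

(* The word map f is the identity or the addition of a letter in the uses
   below. *)
Lemma intcomb_generated y : y \in generated ->
  exists l : seq (int * seq continuum), forall (f : word -> word) psi,
    intcomb [seq (q.1, f q.2) | q <- psi] y =
    \sum_(p <- [seq (q.1 * p.1, (p.2, pattern p.2 (f q.2))) | q <- psi, p <- l])
      p.1%:~R * theta p.2.
Proof.
move=> /asboolP[l Hl]; exists l => f psi.
rewrite /intcomb big_map big_allpairs_dep; apply: eq_bigr => q _ /=.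
rewrite Hl mulr_sumr; apply: eq_bigr => p _ /=.
by rewrite intrM mulrA.
Qed.

(** The combination obtained from [psi] by adding the letter [i] to the words. *)
Definition prepend i psi : seq (int * word) := [seq (q.1, i :: q.2) | q <- psi].

(** Adding the letter [i] to the nodes preserves all the relations. *)
Lemma intcomb_prepend_eq0 i psi y : y \in generated ->
  intcomb psi y \is a Num.int -> intcomb (prepend i psi) y = 0.
Proof.
move=> /intcomb_generated[l Hl] y_int; rewrite /prepend (Hl (cons i)).
have := Hl id psi; rewrite map_id_in; last by case.
move=> E; rewrite E in y_int.
have := thetaP (fun s : node => theta (s.1, [seq i x | x <- s.1] :: s.2)) y_int.
rewrite !big_allpairs_dep => E0; rewrite -[RHS]E0.
apply: eq_bigr => q _; apply: eq_bigr => p _ /=.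
by rewrite mulrzl.
Qed.

Lemma intcomb_int_eq0 psi y : y \in generated ->
  intcomb psi y \is a Num.int -> intcomb psi y = 0.
Proof.
move=> /intcomb_generated[l /(_ id psi)]; rewrite map_id_in; last by case.
move=> -> /(thetaP theta) E; rewrite -[RHS]E.
by apply: eq_bigr => p _; rewrite mulrzl.
Qed.

(** If [i] and [j] differ at the point [x], the two combinations are told apart on
    the generators whose list of points contains [x]. *)
Lemma prepend_separated i j psi : i != j ->
    (forall y, y \in generated ->
      intcomb (prepend i psi) y = intcomb (prepend j psi) y) ->
  forall y, y \in generated -> intcomb psi y = 0.
Proof.
move=> ij Eij.
have [x ijx] : exists x, i x != j x.
  apply: contrapT => /forallNP eq; case/eqP: ij; apply/funext => x.
  by apply/eqP/negPn/negP; exact: eq.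
suff gen0 F : intcomb psi (generator F) = 0.
  move=> y /asboolP[l Hl]; rewrite /intcomb.
  under eq_bigr do rewrite Hl mulr_sumr.
  rewrite exchange_big big1 //= => p _.
  under eq_bigr do rewrite mulrCA.
  by rewrite -mulr_sumr -/(intcomb psi _) gen0 mulr0.
pose patt i q := (x :: F, pattern (x :: F) (i :: q)) : node.
pose r := [seq (q.1, patt i q.2) | q <- psi] ++ [seq (- q.1, patt j q.2) | q <- psi].
have : \sum_(p <- r) p.1%:~R * theta p.2 \is a Num.int.
  have := Eij _ (generator_in (x :: F)); rewrite /intcomb !big_map => E.
  rewrite big_cat !big_map /= [X in X + _]E -big_split /= big1 ?int_num0 // => q _.
  by rewrite mulrNz mulNr subrr.
(* Drops the point x and the first letter, and kills the patterns of the letter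
   j, which is recognized at x. *)
pose g (s : node) : R :=
  if head false (head [::] s.2) == i x
  then theta (behead s.1, [seq behead b | b <- behead s.2]) else 0.
move=> /(thetaP g); rewrite big_cat !big_map /=.
rewrite [X in _ + X]big1 ?addr0 => [E|q _]; last first.
  by rewrite /g /= eq_sym (negbTE ijx) mul0rz.
rewrite -[RHS]E; apply: eq_bigr => q _; rewrite /g /= eqxx mulrzl.
congr (theta (F, _) *~ _); rewrite /pattern -map_comp; exact: eq_map.
Qed.

End large_group.

(** * Quotient groups *)

Section quotient_group_theory.
Variables (G : topologicalZmodType) (N : zmodClosed G).

Definition quotient_proj : G -> quotient_group N := \pi_(quotient_group N)%qT.

Lemma quotient_projP a b : quotient_proj a = quotient_proj b <-> a - b \in N.
Proof.
by rewrite (Quotient.idealrBE N); split=> [ab|/eqP //]; apply/eqP; exact: ab.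
Qed.

Lemma quotient_proj_repr (q : quotient_group N) : quotient_proj (repr q) = q.
Proof. exact: reprK. Qed.

Lemma repr_quotient_proj a : repr (quotient_proj a) - a \in N.
Proof. by apply/quotient_projP; rewrite quotient_proj_repr. Qed.

Lemma quotient_group_open (U : set (quotient_group N)) :
  open U = open (quotient_proj @^-1` U).
Proof. by []. Qed.

End quotient_group_theory.

(** * Quotients of the group are large *)

Section large_group_quotients.
Variable R : realType.

(** The group generated by the functions [generator F], with the topology of
    pointwise convergence modulo [1]. *)
Definition large_group : topologicalZmodType := @bohr_group R word (@generated R).

Implicit Types a b : large_group.

Lemma intcomb1 (w : word) (y : word -> R) : intcomb [:: (1, w)] y = y w.
Proof. by rewrite /intcomb big_seq1 mul1r. Qed.

Lemma large_group_hausdorff : hausdorff_space large_group.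
Proof.
apply: bohr_hausdorff => a a_int; apply/val_inj/funext => w /=.
by rewrite -intcomb1 intcomb_int_eq0 ?intcomb1 ?(valP a).
Qed.

Lemma theta_inj : injective (@theta R).
Proof.
move=> s t st.
have : \sum_(p <- [:: (1, s); (-1, t)]) p.1%:~R * theta R p.2 \is a Num.int.
  by rewrite big_cons big_seq1 /= st mulrN1z mulN1r mul1r subrr int_num0.
move=> /(thetaP (fun u => (u == s)%:R : int)); rewrite big_cons big_seq1 /= eqxx.
by case: eqVneq.
Qed.

Lemma large_group_infinite : infinite_set [set: large_group].
Proof.
apply/infiniteP/card_le_injP.
exists (fun n => BohrGroup (generator_in R (nseq n (fun=> false)))) => m n.
move=> /(congr1 (fun a : large_group => a [::])) /theta_inj [] /(congr1 size).
by rewrite !size_nseq.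
Qed.

(** A combination that does not vanish at a point is not an integer there, hence
    is not an integer nearby. *)
Lemma intcomb_neq0_open (psi : seq (int * word)) :
  open [set a : large_group | intcomb psi a != 0].
Proof.
rewrite openE => b /= b_neq0.
have d0 : 0 < dint (intcomb psi b).
  rewrite dint_gt0; apply: contra b_neq0 => b_int.
  by rewrite intcomb_int_eq0 ?(valP b).
pose M : R := \sum_(q <- psi) `|q.1|%:~R.
have M0 : 0 <= M by apply: sumr_ge0 => q _; rewrite ler0z.
have e0 : 0 < dint (intcomb psi b) / (M + 1) by rewrite divr_gt0 // ltr_wpDl.
exists [seq q.2 | q <- psi], (dint (intcomb psi b) / (M + 1)) => // a near_a.
apply/negP => /eqP a0.
have : dint (intcomb psi (a - b : word -> R))
    <= M * (dint (intcomb psi b) / (M + 1)).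
  rewrite /M mulr_suml /intcomb big_seq [leRHS]big_seq.
  elim/big_ind2 : _ => [|u1 v1 u2 v2 uv1 uv2|q q_psi].
  - by rewrite dint0.
  - by apply: (le_trans (dintD _ _)); exact: lerD.
  - apply: (le_trans (dintM_int _ _)); apply: ler_wpM2l; first by rewrite ler0z.
    by apply/ltW/near_a/mapP; exists q.
rewrite intcombB a0 sub0r dintN mulrCA leNgt => /negP; apply.
by rewrite gtr_pMr // ltr_pdivrMr ?ltr_wpDl // mul1r ltrDl.
Qed.

(** Kronecker's theorem; by independence, integral values are zero. *)
Lemma closed_subgroup_relation (N : zmodClosed large_group) (x : large_group) :
    closed [set a | a \in N] -> x \notin N ->
  exists2 psi, {in N, forall a : large_group, intcomb psi a = 0} &
               intcomb psi x != 0.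
Proof.
move=> Ncl xN.
have : nbhs x (~` [set a | a \in N]).
  by apply: open_nbhs_nbhs; split; [exact: closed_openC|exact/negP].
move=> [ws [e e0 sN]].
pose N' := [set y : word -> R | exists2 a : large_group, a \in N & y = bohr_val a].
have N'0 : N' 0 by exists 0; rewrite ?rpred0.
have N'B y z : N' y -> N' z -> N' (y - z).
  by move=> [a aN ->] [b bN ->]; exists (a - b); rewrite ?rpredB.
have [|psi psiN psix] := @kronecker R word N' N'0 N'B x ws e e0.
  move=> _ [a aN ->]; apply: contrapT => /forall2NP off.
  apply: (sN a) aN => w wws.
  by rewrite ltNge; apply/negP => le; have [/(_ wws)|/(_ le)] := off w.
exists psi; last by apply: contra psix => /eqP ->; rewrite int_num0.
by move=> a aN; rewrite intcomb_int_eq0 ?(valP a) // psiN //; exists a.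
Qed.

Lemma intcomb_cat_opp (psi phi : seq (int * word)) (y : word -> R) :
  intcomb (psi ++ [seq (- q.1, q.2) | q <- phi]) y = intcomb psi y - intcomb phi y.
Proof.
rewrite /intcomb big_cat big_map /= -sumrN; congr (_ + _).
by apply: eq_bigr => q _; rewrite mulrNz mulNr.
Qed.

(** Sending a letter [i] to the restriction to a dense set of the character given
    by [prepend i psi] embeds the power set of the continuum into the set of
    families of reals indexed by that set. *)
Lemma has_small_quotients_large k : has_small_quotients k ->
  ~ ([set: k -> bool] #<= [set: continuum]).
Proof.
move=> small kc.
have [N [Ncl Ninf dens]] := small large_group large_group_hausdorff
  (@bohr_precompact _ _ _) large_group_infinite.
have [x xN] : exists x, x \notin N.
  apply: contrapT => /forallNP allN; apply: Ninf.
  apply: (@sub_finite_set _ _ [set quotient_proj N 0]); last exact: finite_set1.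
  move=> q _; rewrite /= -[q]quotient_proj_repr; apply/quotient_projP.
  by rewrite subr0; exact/negPn/negP/allN.
have [psi psiN psix] := closed_subgroup_relation Ncl xN.
have [[D denseD Dk] _] := densityP (quotient_group N).
(* Characters of the quotient that agree on a dense set agree everywhere. *)
have dense_eq i j :
    (forall q, D q -> intcomb (prepend i psi) (repr q : large_group)
       = intcomb (prepend j psi) (repr q : large_group)) -> i = j.
  move=> ijD; apply/eqP/negPn/negP => ij; case/negP: psix; apply/eqP.
  apply: (prepend_separated ij); last exact: valP.
  move=> y y_in; pose b : large_group := BohrGroup y_in.
  pose chi := prepend i psi ++ [seq (- q.1, q.2) | q <- prepend j psi].
  have chiE (a : large_group) : intcomb chi a
      = intcomb (prepend i psi) a - intcomb (prepend j psi) a.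
    exact: intcomb_cat_opp.
  apply/eqP; rewrite -subr_eq0 -[y]/(bohr_val b) -chiE; apply/negPn/negP => chib.
  have chiN (a : large_group) :
      intcomb chi (repr (quotient_proj N a)) = intcomb chi a.
    apply/eqP; rewrite -subr_eq0 -intcombB.
    have := repr_quotient_proj N a; set c := repr _ - a => cN.
    rewrite -[_ - _]/(bohr_val c) chiE !intcomb_prepend_eq0 ?subrr ?(valP c) //.
      by rewrite psiN // int_num0.
    by rewrite psiN // int_num0.
  pose O := [set q : quotient_group N | intcomb chi (repr q : large_group) != 0].
  have [||q [Oq Dq]] := denseD O.
  - by exists (quotient_proj N b); rewrite /O /= chiN.
  - rewrite quotient_group_open.
    have -> : quotient_proj N @^-1` O = [set a : large_group | intcomb chi a != 0].
      by apply/seteqP; split=> a; rewrite /O /= chiN.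
    exact: intcomb_neq0_open.
  - by move: Oq; rewrite /O /= chiE ijD // subrr eqxx.
have [/card_leP[g]] : D #<= [set: k] by rewrite (card_le_eql Dk).
have [h hinj] := (card_le_injP _ _).1 (real_le_continuum R).
pose value i (q : quotient_group N) :=
  intcomb (prepend i psi) (repr q : large_group).
(* The bits of the values, indexed by the elements of k. *)
pose code (i : continuum -> bool) (n : nat) (t : k) : bool :=
  `[< exists2 q : set_type D, set_val (g q) = t & h (value i (set_val q)) n >].
apply: (@cantor_power continuum).
apply: (card_le_trans _ (continuum_seq kc)); apply/card_le_injP.
exists code => i j ij; apply: dense_eq => q Dq; apply: hinj; apply/funext => n.
pose d : set_type D := SigSub (mem_set Dq).
have codeE l : code l n (set_val (g d)) = h (value l q) n.
  apply/asboolP/idP => [[d' gd' hd']|hq]; last by exists d.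
  have dd' : d' = d by apply: (@inj _ _ _ g); rewrite ?in_setT //; exact: val_inj.
  by rewrite dd' in hd'.
by rewrite -[LHS]codeE -[RHS]codeE ij.
Qed.

End large_group_quotients.

(** * Quotients of density at most the continuum *)

Lemma nat_le_continuum : [set: nat] #<= [set: continuum].
Proof.
apply/card_le_injP; exists (fun m n => m == n) => m m' /(congr1 (@^~ m')).
by rewrite eqxx => /eqP.
Qed.

(** Neighborhoods of [0] with [V n.+1 - V n.+1] contained in [V n] and avoiding
    [d n]. *)
Lemma nbhs0_chain (G : topologicalZmodType) (d : nat -> G) : hausdorff_space G ->
  exists V : nat -> set G, [/\ forall n, nbhs (0 : G) (V n) &
    forall n u v, V n.+1 u -> V n.+1 v ->
      V n (u - v) /\ (d n != 0 -> u - v != d n)].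
Proof.
move=> hG.
have step n (U : {U : set G | nbhs (0 : G) U}) :
  exists V : {V : set G | nbhs (0 : G) V},
    forall u v, sval V u -> sval V v -> sval U (u - v) /\ (d n != 0 -> u - v != d n).
  case: U => U nU /=.
  have nW : nbhs (0 : G) (U `&` [set z | d n != 0 -> z != d n]).
    apply: filterI => //; have [->|dn] := eqVneq (d n) 0.
      by apply: (filterS _ filterT) => z _.
    have cl : closed [set d n].
      by apply: accessible_closed_set1; exact: hausdorff_accessible.
    have : nbhs (0 : G) (~` [set d n]).
      apply: open_nbhs_nbhs; split; first exact: closed_openC.
      by move=> /= /esym /eqP; apply/negP.
    by apply: filterS => z /= /eqP.
  have sub0 : nbhs (0 - 0 : G) (U `&` [set z | d n != 0 -> z != d n]).
    by rewrite subr0.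
  have [[A B] /= [nA nB] AB] := @tvs.sub_continuous G (0, 0) _ sub0.
  exists (exist _ (A `&` B) (filterI nA nB)) => u v /= [Au Bu] [Av Bv].
  by have [] := AB (u, v) (conj Au Bv).
pose next n U := sval (cid (step n U)).
have nT : nbhs (0 : G) setT by exact: filterT.
pose start := exist (fun U : set G => nbhs (0 : G) U) setT nT.
pose fix V n := if n is m.+1 then next m (V m) else start.
exists (fun n => sval (V n)); split=> [n|n u v]; first exact: svalP (V n).
exact: (svalP (cid (step n (V n)))).
Qed.

(** The codes number the centers of finitely many translates of [U] that cover
    [G]. *)
Lemma precompact_cover (G : topologicalZmodType) (U : set G) :
    precompact_group G -> nbhs (0 : G) U ->
  exists f : G -> nat, forall a b, f a = f b -> exists2 c, U (a - c) & U (b - c).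
Proof.
move=> pG /pG[F finF cover].
have /countable_injP[code code_inj] := finite_set_countable finF.
have center a : exists c, F c /\ U (a - c).
  have [c Fc [u Uu <-]] : [set c + u | c in F & u in U] a by rewrite -cover.
  by exists c => //; rewrite addrAC subrr add0r.
have [center_of centerP] := choice center.
exists (code \o center_of) => a b /= cab.
have [[Fa Ua] [Fb Ub]] := (centerP a, centerP b).
exists (center_of a) => //.
by rewrite (code_inj _ _ _ _ cab) ?inE.
Qed.

Lemma has_small_quotients_continuum : has_small_quotients continuum.
Proof.
move=> G hG pG /infiniteP/card_le_injP[x xinj].
(* The differences x i - x j are enumerated by the codes of the pairs (i, j). *)
pose d n := if @unpickle (nat * nat)%type n is Some p then x p.1 - x p.2 else 0.
have [V [nV VB]] := nbhs0_chain d hG.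
have V0 n : V n 0 by exact: nbhs_singleton.
pose S : {pred G} := fun y => `[< forall n, V n y >].
have S_zmod : zmod_closed S.
  split=> [|y z /asboolP Sy /asboolP Sz]; first exact/asboolP.
  by apply/asboolP => n; have [] := VB n _ _ (Sy n.+1) (Sz n.+1).
pose N : zmodClosed G := HB.pack S (GRing.isZmodClosed.Build G S S_zmod).
have NP y : (y \in N) <-> forall n, V n y by split=> /asboolP.
exists N; split.
- move=> y cly; apply/NP => n.
  have nB : nbhs y [set z | V n.+1 (z - y)].
    have cst : continuous (fun t : G => t - y).
      move=> t; apply: (@continuous_comp G (G * G)%type G
        (fun t => (t, y)) (fun p => p.1 - p.2)); last exact: tvs.sub_continuous.
      by apply: cvg_pair; [exact: cvg_id|exact: cvg_cst].
    by apply: (cst y); rewrite /= subrr; exact: nV.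
  have [z [/NP Nz /= Vz]] := cly _ nB.
  by have [+ _] := VB n _ _ (Nz n.+1) Vz; rewrite opprB addrC subrK.
- apply/infiniteP/card_le_injP; exists (quotient_proj N \o x) => i j /=.
  move=> /quotient_projP/NP Nij; apply/eqP/negPn/negP => ij.
  have [_] := VB (pickle (i, j)) _ _ (Nij _) (V0 _).
  rewrite subr0 /d pickleK /= eqxx => /(_ _)/negP; apply=> //.
  by rewrite subr_eq0; apply: contra ij => /eqP/xinj ->.
- apply: (card_le_trans (density_le _)).
  apply: (card_le_trans _ (continuum_seq nat_le_continuum)).
  have [f fP] := choice (fun n => precompact_cover pG (nV n)).
  apply/card_le_injP; exists (fun q n => f n.+1 (repr q)) => q r qr.
  rewrite -[q]quotient_proj_repr -[r]quotient_proj_repr.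
  apply/quotient_projP/NP => n.
  have [c Vqc Vrc] := fP n.+1 _ _ (congr1 (fun u => u n) qr).
  have [+ _] := VB n _ _ Vqc Vrc.
  by rewrite opprB addrA subrK.
Qed.

(** * The least density of infinite quotients *)

Lemma quotient_densityP : is_least_card has_small_quotients quotient_density.
Proof.
by apply: least_cardP; exists continuum; exact: has_small_quotients_continuum.
Qed.

Lemma card_succP k : is_least_card (card_lt k) (card_succ k).
Proof.
apply: least_cardP; exists (k -> bool); split; last exact: cantor_power.
apply/card_le_injP; exists (fun a b => `[< a = b >]) => a b /(congr1 (@^~ b)).
by move=> /asboolP; rewrite asboolT.
Qed.

Lemma weak_power2P k (mu : Type) : card_lt mu k ->
  [set: mu -> bool] #<= [set: weak_power2 k].
Proof.
have [|] := @least_cardP (fun s => forall mu : Type,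
    card_lt mu k -> [set: mu -> bool] #<= [set: s]); last by move=> + _; exact.
by exists (k -> bool) => nu [nuk _]; exact: le_power2.
Qed.

Theorem theorem2p2 :
  [set: card_ln (card_succ continuum)] #<= [set: quotient_density] /\
  ([set: weak_power2 continuum] #= [set: continuum] ->
   [set: quotient_density] #= [set: continuum]).
Proof.
have [small least] := quotient_densityP.
have large := has_small_quotients_large Rdefinitions.R small.
split.
  have ex : exists mu, [set: card_succ continuum] #<= [set: mu -> bool].
    exists quotient_density.
    by apply: (card_succP continuum).2; exact: not_card_le.
  have [_] := least_cardP ex; apply.
  by apply: (card_succP continuum).2; exact: not_card_le.
move=> wc; apply: contrapT => neq; apply: large.
rewrite -(card_le_eqr wc); apply: weak_power2P; apply: not_card_le => le.
apply: neq; rewrite card_eq_le le andbT.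
exact: least has_small_quotients_continuum.
Qed.
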